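(* For any $m,n\in\mathbb{N}$ with $n\geq 1$, $$\sum_{N_{m+1}=1}^{n}\cdots \sum_{N_2=1}^{N_3}\sum_{N_1=1}^{N_2}\frac{1}{N_1}=\binom{n+m}{m}\sum_{N=1+m}^{n+m}\frac{1}{N}.$$
   Context: $\mathbb{N}=\{0,1,2,\dots\}$. The left-hand side is an $(m+1)$-fold nested sum: with $N_{m+2}:=n$, the index $N_j$ runs from $1$ to $N_{j+1}$ for $j=m+1,m,\dots,1$; for $m=0$ it is $\sum_{N_1=1}^{n}\frac{1}{N_1}$. *)

(* Defs.v *)
From mathcomp Require Import all_boot all_order all_algebra.

Set Implicit Arguments.
Unset Strict Implicit.
Unset Printing Implicit Defensive.

Import GRing.Theory.
Local Open Scope ring_scope.

(* The k-fold sum of a N_1 over 1 <= N_j <= N_(j+1) for j = k, ..., 1, where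
   N_(k+1) := n; the recursion peels off the outermost sum, over N_k.
   The 0-fold sum is the summand a n itself. *)
Fixpoint nested_sum (k : nat) (a : nat -> rat) (n : nat) : rat :=
  if k is k'.+1 then \sum_(1 <= N < n.+1) nested_sum k' a N else a n.

(* Main.v *)
Require Import Defs.
From mathcomp Require Import all_boot all_order all_algebra.
From mathcomp Require Import ring.

Set Implicit Arguments.
Unset Strict Implicit.
Unset Printing Implicit Defensive.

Import GRing.Theory.
Local Open Scope ring_scope.

(** Peeling the last term off the outermost sum shows that the left-hand side
    L(m, n) satisfies L(m+1, n+1) = L(m+1, n) + L(m, n+1), with L(m, 0) = 0 and
    L(0, n) the n-th harmonic number. These relations determine L, so it is
    enough that the right-hand side satisfies them as well
    ([hyperharmonicS]). Both sides are the hyperharmonic numbers, and the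
    recurrence is Pascal's rule corrected by the absorption identity
    (m+1) C(n+m+2, m+1) = (n+m+2) C(n+m+1, m), which accounts for the end terms
    by which the three harmonic segments differ. *)

Definition hyperharmonic (m n : nat) : rat :=
  'C(n + m, m)%:R * \sum_((1 + m)%N <= N < (n + m).+1) 1 / N%:R.

Lemma nested_sumS (k : nat) (a : nat -> rat) (n : nat) :
  nested_sum k.+1 a n.+1 = nested_sum k.+1 a n + nested_sum k a n.+1.
Proof. by rewrite /= big_nat_recr. Qed.

(** With T the sum of 1/N over m+2 <= N <= n+m+1, A = C(n+m+1, m+1) and
    B = C(n+m+1, m), the claim reads
    (A + B)(T + 1/(n+m+2)) = A T + B (1/(m+1) + T); the terms in T cancel, and
    what is left is the absorption identity. *)
Lemma hyperharmonicS (m n : nat) :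
  hyperharmonic m.+1 n.+1 = hyperharmonic m.+1 n + hyperharmonic m n.+1.
Proof.
rewrite /hyperharmonic !add1n !addSn !addnS.
rewrite [in LHS]big_nat_recr /=; last by rewrite !ltnS leq_addl.
rewrite [X in _ = _ + _ * X]big_ltn; last by rewrite !ltnS leq_addl.
have absorb := congr1 (fun k : nat => k%:R : rat)
  (mul_bin_diag (n + m).+2 m).
rewrite /= binS !natrM natrD in absorb.
rewrite binS natrD.
set T := \sum_(m.+2 <= N < (n + m).+2) _.
move: absorb.
have nz1 : (m.+1%:R : rat) != 0 by rewrite Num.Theory.pnatr_eq0.
have nz2 : ((n + m).+2%:R : rat) != 0 by rewrite Num.Theory.pnatr_eq0.
move: nz1 nz2.
move: (m.+1%:R : rat) ((n + m).+2%:R : rat) => p q nz1 nz2.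
move: ('C(_, m.+1)%:R : rat) ('C(_, m)%:R : rat) => A B absorb.
have endterms : (A + B) / q = B / p.
  by apply/eqP; rewrite eqr_div // mulrC -absorb mulrC.
by rewrite !div1r mulrDr endterms; ring.
Qed.

Lemma nested_sum_hyperharmonic (m n : nat) :
  nested_sum m.+1 (fun N => 1 / N%:R) n = hyperharmonic m n.
Proof.
elim: m n => [|m IHm] n.
  by rewrite /hyperharmonic bin0 mul1r !addn0.
elim: n => [|n IHn]; first by rewrite /hyperharmonic /= !big_geq ?mulr0.
by rewrite nested_sumS IHn IHm hyperharmonicS.
Qed.

Theorem corollary4p3 (m n : nat) (hn : (1 <= n)%N) :
  nested_sum m.+1 (fun N => 1 / N%:R) n =
  'C(n + m, m)%:R * \sum_((1 + m)%N <= N < (n + m).+1) 1 / N%:R.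
Proof. exact: nested_sum_hyperharmonic. Qed.
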